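(* Let $1\le p<\infty$. For every real $\varepsilon>0$ and every integer $n\ge1$, $$\mathrm{Widim}_\varepsilon\big(B_{\ell^p}(\mathbb{R}^n),d_{\ell^\infty}\big)=\min\big(n,\ \lceil(2/\varepsilon)^p\rceil-1\big).$$
   Context: For a compact metric space $(X,d)$, a topological space $Y$ and $\varepsilon>0$, a continuous map $f:X\to Y$ is called an $\varepsilon$-embedding if $\mathrm{Diam}\, f^{-1}(y)\le\varepsilon$ for all $y\in Y$ (diameter with respect to $d$). $\mathrm{Widim}_\varepsilon(X,d)$ is the minimum integer $k\ge 0$ such that there exist a $k$-dimensional polyhedron $P$ (the underlying topological space of a $k$-dimensional simplicial complex) and an $\varepsilon$-embedding $f:X\to P$. $B_{\ell^p}(\mathbb{R}^n)=\{x\in\mathbb{R}^n : \sum_{k=1}^n|x_k|^p\le1\}$ and $d_{\ell^\infty}(x,y)=\max_{1\le k\le n}|x_k-y_k|$. $\lceil a\rceil$ denotes the smallest integer $\ge a$. *)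

(* Defs.v *)
From HB Require Import structures.
From mathcomp Require Import all_boot all_order all_algebra finmap.
From mathcomp Require Import all_classical all_reals all_analysis.

Set Implicit Arguments.
Unset Strict Implicit.
Unset Printing Implicit Defensive.

Import Order.TTheory GRing.Theory Num.Theory.
Import numFieldNormedType.Exports.

Local Open Scope classical_set_scope.
Local Open Scope ring_scope.

(* Abstract simplicial complex with vertex set V; V and the set of faces may be
   infinite, and the empty simplex is not a face. *)
Record simplicial_complex (V : choiceType) := SimplicialComplex {
  face :> {fset V} -> Prop ;
  face_nonempty : forall s : {fset V}, face s -> s != fset0 ;
  face_vertex : forall v : V, face [fset v]%fset ;
  face_subset : forall s t : {fset V},
    face s -> (t `<=` s)%fset -> t != fset0 -> face t }.

Definition complex_dim (V : choiceType) (K : simplicial_complex V) (k : nat) :=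
  (exists2 s : {fset V}, K s & #|` s| = k.+1) /\
  (forall s : {fset V}, K s -> (#|` s| <= k.+1)%N).

(* The closed geometric simplex |s|, in barycentric coordinates. *)
Definition simplex (R : realType) (V : choiceType) (s : {fset V}) :
    set (V -> R) :=
  [set x | [/\ forall v, 0 <= x v, forall v, v \notin s -> x v = 0
             & \sum_(v <- s) x v = 1]].

Record polyhedron (R : realType) (V : choiceType) (K : simplicial_complex V) :=
  Polyhedron {
    bary :> V -> R ;
    baryP : exists2 s : {fset V}, K s & simplex s bary }.

(* The weak (coherent) topology on |K|: U is open iff its trace on every closed
   simplex |s| is open for the Euclidean topology of |s|, a subset of R^s. *)
Definition weak_open (R : realType) (V : choiceType) (K : simplicial_complex V)
    (U : set (polyhedron R K)) : Prop :=
  forall s : {fset V}, K s ->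
  forall x : polyhedron R K, simplex s x -> U x ->
  exists2 e : R, 0 < e &
    forall y : polyhedron R K, simplex s y ->
      (forall v, v \in s -> `|x v - y v| < e) -> U y.

Section weak_topology.
Variables (R : realType) (V : choiceType) (K : simplicial_complex V).

Let weak_openT : weak_open [set: polyhedron R K].
Proof. by move=> s Ks x xs _; exists 1. Qed.

Let weak_openI : setI_closed (@weak_open R V K).
Proof.
move=> A B oA oB s Ks x xs [Ax Bx].
have [e e0 He] := oA s Ks x xs Ax; have [d d0 Hd] := oB s Ks x xs Bx.
exists (Num.min e d); first by rewrite lt_min e0 d0.
move=> y ys xy; split.
  by apply: He => // v /xy; rewrite lt_min => /andP[].
by apply: Hd => // v /xy; rewrite lt_min => /andP[].
Qed.

Let weak_open_bigU (I : Type) (f : I -> set (polyhedron R K)) :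
  (forall i, weak_open (f i)) -> weak_open (\bigcup_i f i).
Proof.
move=> of_ s Ks x xs [i _ fx]; have [e e0 He] := of_ i s Ks x xs fx.
by exists e => // y ys xy; exists i => //; exact: He.
Qed.

HB.instance Definition _ := gen_eqMixin (polyhedron R K).
HB.instance Definition _ := gen_choiceMixin (polyhedron R K).
HB.instance Definition _ := isOpenTopological.Build (polyhedron R K)
  weak_openT weak_openI weak_open_bigU.

End weak_topology.

(* diam set0 = -oo: empty fibres impose no constraint below. *)
Definition diam (R : realType) (X : metricType R) (A : set X) : \bar R :=
  ereal_sup [set (mdist z.1 z.2)%:E | z in A `*` A].

Definition eps_embedding (R : realType) (X : metricType R)
    (Y : topologicalType) (eps : R) (f : X -> Y) : Prop :=
  continuous f /\ forall y : Y, (diam (f @^-1` [set y]) <= eps%:E)%E.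

Definition embeds_in_dim (R : realType) (X : metricType R) (eps : R)
    (k : nat) : Prop :=
  exists (V : choiceType) (K : simplicial_complex V)
    (f : X -> polyhedron R K), complex_dim K k /\ eps_embedding eps f.

(* Widim_eps(X, d) = m: the minimum exists and equals m. *)
Definition is_Widim (R : realType) (X : metricType R) (eps : R)
    (m : int) : Prop :=
  [set k%:Z | k in embeds_in_dim X eps] m /\
  lbound [set k%:Z | k in embeds_in_dim X eps] m.

Record lp_ball (R : realType) (p : R) (n : nat) := LpBall {
  lp_ball_val :> 'rV[R]_n ;
  lp_ballP : \sum_(k < n) `|lp_ball_val ord0 k| `^ p <= 1 }.

Definition linf_dist (R : realType) (n : nat) (x y : 'rV[R]_n) : R :=
  \big[Num.max/0]_(k < n) `|x ord0 k - y ord0 k|.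

Section linf_metric.
Variables (R : realType) (p : R) (n : nat).

HB.instance Definition _ := [isSub for @lp_ball_val R p n].
HB.instance Definition _ := [Choice of lp_ball p n by <:].

Let d (x y : lp_ball p n) : R := linf_dist x y.

Let le_d (x y : lp_ball p n) (k : 'I_n) : `|x ord0 k - y ord0 k| <= d x y.
Proof. exact: (le_bigmax _ (fun k => `|x ord0 k - y ord0 k|)). Qed.

Let d_ge0 (x y : lp_ball p n) : 0 <= d x y.
Proof. exact: bigmax_ge_id. Qed.

Let dxx (x : lp_ball p n) : d x x = 0.
Proof.
by apply: le_anti; rewrite d_ge0 andbT bigmax_le// => i _; rewrite subrr normr0.
Qed.

Let d_pos (x y : lp_ball p n) : d x y = 0 -> x = y.
Proof.
move=> dxy; apply: val_inj; apply/rowP => k; apply/eqP.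
by rewrite -subr_eq0 -normr_le0; have := le_d x y k; rewrite dxy.
Qed.

Let d_sym (x y : lp_ball p n) : d x y = d y x.
Proof. by apply: eq_bigr => i _; rewrite distrC. Qed.

Let d_triangle (y x z : lp_ball p n) : d x z <= d x y + d y z.
Proof.
apply: bigmax_le => [|k _]; first by rewrite addr_ge0.
by rewrite (le_trans (ler_distD (y ord0 k) _ _))// lerD// le_d.
Qed.

HB.instance Definition _ := @isMetric.Build R (lp_ball p n) d
  dxx d_pos d_sym d_triangle.

End linf_metric.

(* Main.v *)
(* Upper bound: a point of the ball has fewer than (2/eps)^p coordinates of size
   greater than eps/2, so soft thresholding of the coordinates at eps/2 maps the
   ball to a polyhedron of dimension ceil((2/eps)^p) - 1, and its fibres have
   diameter at most eps; thresholding at 0 gives dimension n.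

   Lower bound: if m <= n and m < (2/eps)^p, the ball contains an m-dimensional
   cube of side greater than eps.  Suppose that the cube has an eps-embedding in a
   polyhedron of dimension k < m.  Its image lies in a finite subcomplex.
   Barycentric coordinates, rescaled so that their maximum is 1, have at most k
   entries other than 0 and 1.  Colour each point of a fine grid of the cube by
   its coordinates multiplied by a large integer q, shifted by some th in [0, 1)
   and rounded down, with th chosen so that the result is locally constant: then
   neighbouring grid points carry at most k + 1 colours, while no colour occurs on
   two opposite faces.  This contradicts the discrete form of Lebesgue's covering
   theorem, which is deduced from Kuhn's cubical version of Sperner's lemma. *)

Require Import Defs.
From mathcomp Require Import all_boot all_order all_algebra finmap.
From mathcomp Require Import all_classical all_reals all_analysis.
From mathcomp Require Import ring lra zify.
Import Order.TTheory GRing.Theory Num.Theory.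
Import numFieldNormedType.Exports.
Local Open Scope ring_scope.

Set Implicit Arguments.
Unset Strict Implicit.
Unset Printing Implicit Defensive.

(** * Kuhn's cubical Sperner lemma *)

Lemma F2D (x : 'F_2) : x + x = 0.
Proof. by case: x => [[|[|]]] // ?; apply: val_inj. Qed.

Lemma F2_eq (x y : 'F_2) : x + y = 0 -> x = y.
Proof. by move=> xy; rewrite -[x]addr0 -(F2D y) addrA xy add0r. Qed.

Section CubicalChains.
Variables (G : zmodType) (I : finType) (e : I -> G) (A : Type) (L : G -> A).

(* [csum rho z S] is the value of the mod 2 cochain [rho] on Kuhn's triangulation
   of the cube based at [z] with edges [e i], [i \in S]: the sum of [rho] over the
   labels along all monotone paths from [z] to the opposite vertex. *)
Fixpoint csum_rec (k : nat) (rho : seq A -> 'F_2) (z : G) (S : {set I}) : 'F_2 :=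
  if k is k'.+1 then
    \sum_(i in S) csum_rec k' (fun s => rho (L z :: s)) (z + e i) (S :\ i)
  else rho [:: L z].

Definition csum rho z (S : {set I}) := csum_rec #|S| rho z S.

Lemma csumS rho z (S : {set I}) : (0 < #|S|)%N ->
  csum rho z S = \sum_(i in S) csum (fun s => rho (L z :: s)) (z + e i) (S :\ i).
Proof.
rewrite /csum; case Sk: #|S| => [//|k] _ /=; apply: eq_bigr => i iS.
by have -> : #|S :\ i| = k by move: Sk; rewrite (cardsD1 i) iS => -[].
Qed.

Lemma csum0 rho z : csum rho z finset.set0 = rho [:: L z].
Proof. by rewrite /csum cards0. Qed.

(** The simplicial coboundary mod 2: all deletions of one entry, without signs. *)
Fixpoint cobound (rho : seq A -> 'F_2) (s : seq A) : 'F_2 :=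
  if s is c :: s' then rho s' + cobound (fun t => rho (c :: t)) s' else 0.

Lemma csumD rho1 rho2 z (S : {set I}) :
  csum (fun s => rho1 s + rho2 s) z S = csum rho1 z S + csum rho2 z S.
Proof.
rewrite /csum; move: #|S| => k; elim: k rho1 rho2 z S => //= k IH rho1 rho2 z S.
by rewrite -big_split; apply: eq_bigr => i _; exact: IH.
Qed.

(** Stokes' formula mod 2. Deleting the first vertex of a path leaves a path in a facet based at
    [z + e i], deleting the last one a path in a facet based at [z]. An intermediate deletion arises
    from exactly two paths, which differ by swapping two consecutive steps. *)
Lemma csum_cobound rho z (S : {set I}) : (0 < #|S|)%N ->
  csum (cobound rho) z S =
  \sum_(i in S) (csum rho (z + e i) (S :\ i) + csum rho z (S :\ i)).
Proof.
move: {2}#|S| (leqnn #|S|) => k; elim: k rho z S => [|k IH] rho z S.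
  by move=> h1 h2; have := leq_trans h2 h1.
move=> Sk S0; rewrite csumS//.
under eq_bigr do rewrite csumD.
rewrite !big_split /=; congr (_ + _).
have cS i : i \in S -> #|S :\ i| = #|S|.-1 by move=> iS; rewrite (cardsD1 i S) iS.
have [S1|S1] := leqP #|S| 1.
  have /cards1P[i Si] : #|S| == 1%N by rewrite eqn_leq S1.
  rewrite Si !big_set1; have -> : [set i] :\ i = finset.set0.
    by apply/setP => j; rewrite !inE andNb.
  by rewrite !csum0 /= addr0.
(* Induction hypothesis on the path after [L z]: the first summand cancels by symmetry in [i] and
   [j]; the second, regrouped by [j], gives [csum rho z (S :\ j)]. *)
transitivity (\sum_(i in S) \sum_(j in S :\ i)
  (csum (fun s => rho (L z :: s)) (z + e i + e j) (S :\ i :\ j) +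
   csum (fun s => rho (L z :: s)) (z + e i) (S :\ i :\ j))).
  apply: eq_bigr => i iS; rewrite IH// cS//; first by rewrite -ltnS prednK.
  by rewrite -ltnS prednK.
rewrite (eq_bigr _ (fun i _ => big_split _ _ _ _ _)) big_split /=.
rewrite [X in X + _](_ : _ = 0) ?add0r.
  rewrite (exchange_big_dep (mem S)) /=; last by move=> i j _;
    rewrite !inE => /andP[].
  apply: eq_bigr => j jS; rewrite csumS ?cS//; last by rewrite -ltnS prednK.
  apply: eq_big => [i|i /andP[iS]]; rewrite !inE eq_sym;
    first by rewrite jS andbT andbC.
  by move=> _; congr csum; rewrite !finset.setDDl finset.setUC.
pose F i j := csum (fun s => rho (L z :: s)) (z + e i + e j) (S :\ i :\ j).
have Fsym i j : F i j = F j i by rewrite /F addrAC !finset.setDDl finset.setUC.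
(* The steps [i, j] and [j, i] reach the same cube, so they cancel mod 2. *)
have h (s : seq I) : uniq s ->
    \sum_(i <- s) \sum_(j <- s | j != i) F i j = 0.
  elim: s => [|a s IHs]; first by rewrite big_nil.
  move=> /= /andP[as_ us]; rewrite big_cons big_cons eqxx /=.
  rewrite [X in _ + X](_ : _ = \sum_(i <- s) F i a +
      \sum_(i <- s) \sum_(j <- s | j != i) F i j).
    rewrite IHs// addr0 [X in X + _](_ : _ = \sum_(i <- s) F i a) ?F2D//.
    rewrite big_seq_cond [RHS]big_seq; apply: eq_big => [i|i _]; last exact: Fsym.
    by case: (eqVneq i a) => [->|]; rewrite ?(negPf as_) ?andbT.
  rewrite -big_split /= big_seq [RHS]big_seq; apply: eq_bigr => i si.
  by rewrite big_cons; case: eqVneq => // ai; rewrite ai si in as_.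
rewrite -[RHS](h (enum S) (enum_uniq _)) big_enum /=; apply: eq_bigr => i iS.
rewrite big_enum_cond /=; apply: eq_bigl => j; by rewrite !inE andbC.
Qed.

Lemma csum_eq0 rho z (S : {set I}) :
  (forall s : seq G,
      (forall y, y \in s -> exists2 T : {set I}, T \subset S &
        y = z + \sum_(i in T) e i) ->
      size s = #|S|.+1 -> rho (map L s) = 0) -> csum rho z S = 0.
Proof.
rewrite /csum; move Sk : #|S| => k; elim: k rho z S Sk => [|k IH] rho z S Sk h /=.
  apply: (h [:: z]) => // y; rewrite inE => /eqP ->; exists finset.set0;
    first by rewrite finset.sub0set.
  by rewrite finset.big_set0 addr0.
apply: big1 => i iS; apply: IH; first by move: Sk; rewrite (cardsD1 i S) iS => -[].
move=> s sT ss; apply: (h (z :: s)) => [y|]; last by rewrite /= ss.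
rewrite inE => /orP[/eqP ->|]; first by exists finset.set0;
  rewrite ?finset.sub0set// finset.big_set0 addr0.
move=> /sT[T TS ->]; exists (i |: T).
  by rewrite finset.subUset finset.sub1set iS (fintype.subset_trans TS)//
    finset.subsetDl.
rewrite big_setU1 ?addrA//; apply: contraTN TS => iT.
by apply/negP => /fintype.subsetP/(_ _ iT); rewrite !inE eqxx.
Qed.

Lemma csum_eq (rho1 rho2 : seq A -> 'F_2) z (S : {set I}) :
  (forall s : seq G,
      (forall y, y \in s -> exists2 T : {set I}, T \subset S &
        y = z + \sum_(i in T) e i) ->
      size s = #|S|.+1 -> rho1 (map L s) = rho2 (map L s)) ->
  csum rho1 z S = csum rho2 z S.
Proof.
move=> h; have : csum (fun s => rho1 s + rho2 s) z S = 0.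
  by apply: csum_eq0 => s sT ss; rewrite h// F2D.
by rewrite csumD => /F2_eq.
Qed.

End CubicalChains.

Definition rainbow (k : nat) (s : seq nat) : 'F_2 := (perm_eq s (iota 0 k.+1))%:R.

Lemma cobound_perm (A : eqType) (rho : seq A -> 'F_2) (s : seq A) :
  (forall s t, perm_eq s t -> rho s = rho t) ->
  cobound rho s = \sum_(c <- s) rho (rem c s).
Proof.
elim: s rho => [|c s IH] rho rhoP /=; first by rewrite big_nil.
rewrite big_cons /= eqxx IH; last by move=> t u tu; apply: rhoP; rewrite perm_cons.
congr (_ + _); apply: eq_big_seq => d ds /=.
case: eqVneq => // cd; apply: rhoP; rewrite cd perm_sym; exact: perm_to_rem.
Qed.

(** Sperner's parity argument: deleting [c] leaves a rainbow list iff [s] is a permutation of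
    [c :: iota 0 k.+1]. At most one value [c] qualifies. It occurs once if it is [k.+1]; otherwise
    it occurs twice and the two deletions cancel. *)
Lemma cobound_rainbow (k : nat) (s : seq nat) :
  all (fun c => c <= k.+1)%N s -> cobound (rainbow k) s = rainbow k.+1 s.
Proof.
move=> sk; rewrite cobound_perm; last first.
  by move=> t u tu; rewrite /rainbow (permPl tu).
have iotaE : perm_eq (iota 0 k.+2) (k.+1 :: iota 0 k.+1).
  by rewrite -addn1 iotaD add0n cats1 perm_rcons.
rewrite big_seq (eq_bigr (fun c => (perm_eq s (c :: iota 0 k.+1))%:R)); last first.
  by move=> c cs; rewrite /rainbow (permPl (perm_to_rem cs)) perm_cons.
rewrite -big_seq /rainbow (permPr iotaE).
have [/hasP[c0 c0s sc0]|/hasPn sN] :=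
    boolP (has (fun c => perm_eq s (c :: iota 0 k.+1)) s).
  have eqc c : perm_eq s (c :: iota 0 k.+1) = (c == c0).
    apply/idP/eqP => [|-> //]; rewrite (permPl sc0) => /permP/(_ (pred1 c)) /=.
    by rewrite eqxx eq_sym; case: eqVneq => // _ /eqP; rewrite eqn_add2r.
  rewrite (eq_bigr (fun c => (c == c0)%:R)) => [|c _]; last by rewrite eqc.
  rewrite eqc -natr_sum (_ : \sum_(c <- s) _ = count_mem c0 s)%N; last first.
    by rewrite -sum1_count [RHS]big_mkcond; apply: eq_bigr => c _ /=; case: eqP.
  rewrite (permP sc0).
  rewrite -[count _ (_ :: _)]/((c0 == c0) + count_mem c0 (iota 0 k.+1))%N.
  rewrite eqxx count_uniq_mem ?iota_uniq// mem_iota add0n /=.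
  have := allP sk _ c0s; rewrite leq_eqVlt eq_sym => /orP[/eqP <-|].
    by rewrite ltnn eqxx.
  by move=> c0k; rewrite c0k (gtn_eqF c0k); apply: val_inj.
rewrite big_seq big1 => [|c /sN/negPf -> //].
case: (boolP (perm_eq _ _)) => // sP.
have ks : k.+1 \in s by rewrite (perm_mem sP) mem_head.
by have := sN _ ks; rewrite sP.
Qed.

Section Kuhn.
Variables m M : nat.
Let grid := {ffun 'I_m -> 'I_M.+2}.

(** Addition in ['I_M.+2] is modulo [M.+2], so a step from [ord_max] wraps around to [ord0]; [box]
    excludes the base points where an edge would do so. *)
Definition grid_step (i : 'I_m) : grid := [ffun j => if j == i then 1 else 0].

Lemma sum_grid_step (T : {set 'I_m}) (j : 'I_m) :
  (\sum_(i in T) grid_step i) j = if j \in T then 1 else 0.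
Proof.
rewrite sum_ffunE; under eq_bigr do rewrite ffunE.
case: ifP => jT; last first.
  by apply: big1 => i iT; case: eqP => // ji; rewrite ji iT in jT.
by rewrite (bigD1 j)//= eqxx big1 ?addr0// => i /andP[_];
  rewrite eq_sym => /negPf ->.
Qed.

Lemma rainbow_missing k (s : seq nat) j : (j <= k)%N -> j \notin s ->
  rainbow k s = 0.
Proof.
move=> jk js; rewrite /rainbow; case: (boolP (perm_eq _ _)) => // /perm_mem/(_ j).
by rewrite mem_iota (negPf js) add0n ltnS jk.
Qed.

Variable lam : grid -> nat.
Hypothesis lam_le : forall z, (lam z <= m)%N.
Hypothesis lam0 : forall (z : grid) (i : 'I_m), z i = ord0 -> lam z != i.
Hypothesis lamM : forall (z : grid) (i : 'I_m), z i = ord_max -> (lam z <= i)%N.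

Definition lower (j : nat) : {set 'I_m} := [set i : 'I_m | (i < j)%N].

(** Base points of the [j]-dimensional unit cubes that tile the face where all coordinates of index
    at least [j] are maximal. *)
Definition box (j : nat) (z : grid) :=
  [forall i : 'I_m, if (i < j)%N then z i != ord_max else z i == ord_max].

Lemma card_lower j : (j <= m)%N -> #|lower j| = j.
Proof.
move=> jm; rewrite -sum1_card (eq_bigl (fun i : 'I_m => i < j)%N) => [|i].
  by rewrite (big_ord_narrow jm) sum_nat_const card_ord muln1.
by rewrite inE.
Qed.

(* By [csum_cobound] the sum telescopes to the facets of the box; the Sperner
   conditions kill all of them except the one where coordinate [j] is maximal. *)
Lemma sum_rainbow j : (j <= m)%N ->
  \sum_(z | box j z) csum grid_step lam (rainbow j) z (lower j) = 1.
Proof.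
elim: j => [|j IH] jm.
  pose z0 : grid := [ffun=> ord_max].
  have l0 : lower 0 = finset.set0 by apply/setP => i; rewrite !inE.
  rewrite (big_pred1 z0) => [|z].
    rewrite l0 csum0 /rainbow [lam z0](_ : _ = 0%N) ?eqxx//.
    apply/eqP; rewrite -leqn0.
    have [m0|m0] := posnP m; first by rewrite -m0 lam_le.
    by rewrite (lamM (i := Ordinal m0))// ffunE.
  apply/forallP/eqP => [zM|-> i]; last by rewrite ffunE.
  by apply/ffunP => i; rewrite ffunE; apply/eqP; exact: zM.
rewrite (eq_bigr (fun z => \sum_(i in lower j.+1)
   (csum grid_step lam (rainbow j) (z + grid_step i) (lower j.+1 :\ i) +
    csum grid_step lam (rainbow j) z (lower j.+1 :\ i)))); last first.
  move=> z /forallP zb; rewrite -csum_cobound; last by rewrite card_lower.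
  (* Coordinate [j.+1], if it exists, is maximal on this face, so [lamM] bounds the labels by
     [j.+1]. *)
  apply: csum_eq => s sT _; rewrite cobound_rainbow//.
  apply/allP => c /mapP[y /sT[T /fintype.subsetP TS ->] ->].
  have [jm'|jm'] := ltnP j.+1 m; last by rewrite (leq_trans (lam_le _)).
  apply: (@lamM _ (Ordinal jm')); rewrite ffunE sum_grid_step.
  case: ifP => [/TS|_]; first by rewrite inE /= ltnn.
  by have := zb (Ordinal jm'); rewrite /= ltnn addr0 => /eqP.
rewrite exchange_big /=.
pose jj := Ordinal jm.
have ljj : jj \in lower j.+1 by rewrite inE /=.
have e1 : ord_max + 1 = ord0 :> 'I_M.+2.
  by apply: val_inj; rewrite /= modnDmr addn1 modnn.
pose rest (i : 'I_m) (z : grid) : bool := [forall (k | k != i),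
  if (k < j.+1)%N then z k != ord_max else z k == ord_max].
have boxE i z : i \in lower j.+1 -> box j.+1 z = rest i z && (z i != ord_max).
  move=> ij; apply/forallP/andP => [zb|[/forall_inP zr zi] k].
    split; last by have := zb i; rewrite inE in ij; rewrite ij.
    by apply/forall_inP => k _; exact: zb.
  by have [->|/zr//] := eqVneq k i; rewrite inE in ij; rewrite ij.
(* Translation by [grid_step i] permutes the cyclic grid, so every layer in direction [i] except
   [ord_max] and [ord0] is counted twice. *)
have tele (i : 'I_m) (h : grid -> 'F_2) : i \in lower j.+1 ->
    \sum_(z | box j.+1 z) (h (z + grid_step i) + h z) =
    \sum_(z | rest i z && (z i == ord_max)) h z +
    \sum_(z | rest i z && (z i == ord0)) h z.
  move=> ij; rewrite big_split /=.
  have reind : \sum_(z | box j.+1 z) h (z + grid_step i) =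
      \sum_(z | rest i z && (z i != ord0)) h z.
    rewrite [RHS](reindex_inj (addIr (grid_step i))); apply: eq_bigl => z.
    rewrite (boxE i)//; congr (_ && ~~ _).
      by apply: eq_forallb_in => k ki; rewrite !ffunE (negPf ki) addr0.
    by rewrite !ffunE eqxx -e1 (inj_eq (addIr 1)).
  rewrite reind (eq_bigl _ _ (fun z => boxE i z ij)).
  have := F2D (\sum_(z | rest i z) h z).
  rewrite {1}(bigID (fun z : grid => z i == ord0)) /=.
  rewrite [X in _ + X](bigID (fun z : grid => z i == ord_max)) /=.
  move=> h0; apply: F2_eq; rewrite -[RHS]h0 [X in _ + X = _]addrC addrACA.
  by congr (_ + _); rewrite addrC.
have sub0 (i : 'I_m) (T : {set 'I_m}) : T \subset lower j.+1 :\ i -> i \notin T.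
  by move=> /fintype.subsetP TS; apply/negP => /TS; rewrite !inE eqxx.
have face0 (i : 'I_m) : i \in lower j.+1 ->
    \sum_(z | rest i z && (z i == ord0)) csum grid_step lam (rainbow j) z
      (lower j.+1 :\ i) = 0.
  rewrite inE ltnS => ij; apply: big1 => z /andP[_ /eqP zi];
    apply: csum_eq0 => s sT _.
  apply: (rainbow_missing ij); apply/mapP => -[y /sT[T /sub0 iT yE] iE].
  have := @lam0 y i; rewrite -iE eqxx yE ffunE sum_grid_step (negPf iT) addr0.
  by move=> /(_ zi).
rewrite (bigD1 jj)//= (tele _ (fun z => csum _ _ _ z _))// face0// addr0.
rewrite [X in _ + X]big1 ?addr0 => [|i /andP[ij ijj]]; last first.
  rewrite (tele _ (fun z => csum _ _ _ z _))// face0// addr0.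
  have {ijj} ltij : (i < j)%N.
    rewrite inE ltnS leq_eqVlt in ij; rewrite -val_eqE /= in ijj.
    by rewrite (negPf ijj) in ij.
  apply: big1 => z /andP[_ /eqP zi]; apply: csum_eq0 => s sT _.
  apply: (rainbow_missing (leqnn j)); apply/mapP => -[y /sT[T /sub0 iT yE] jE].
  have := @lamM y i; rewrite -jE yE ffunE sum_grid_step (negPf iT) addr0.
  by move=> /(_ zi); rewrite leqNgt ltij.
have jjE (i : 'I_m) : i != jj -> (i == j :> nat) = false by move=> /negPf.
rewrite -[RHS]IH ?(ltnW jm)//; apply: eq_big => [z|z _].
  apply/andP/forallP => [[/forall_inP zr zj] i|zb].
    have [ij|ij] := eqVneq i jj; first by rewrite ij /= ltnn.
    by have := zr _ ij; rewrite [(i < j.+1)%N]ltnS leq_eqVlt (jjE _ ij).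
  split; last by have := zb jj; rewrite /= ltnn.
  apply/forall_inP => i ij.
  by have := zb i; rewrite [(i < j.+1)%N]ltnS [(i <= j)%N]leq_eqVlt (jjE _ ij).
congr csum; apply/setP => i; rewrite !inE ltnS -val_eqE /=.
by case: ltngtP.
Qed.

(** The sum in [sum_rainbow] for [j = m] is odd, so some cube has a rainbow path. *)
Lemma kuhn : exists (z : grid) (s : seq grid), [/\ forall i, z i != ord_max,
  forall y, y \in s -> forall i, (z i <= y i <= (z i).+1)%N &
  perm_eq (map lam s) (iota 0 m.+1)].
Proof.
apply: contrapT => noz.
have := sum_rainbow (leqnn m); rewrite big1 => [/esym/eqP|z /forallP zb].
  by rewrite oner_eq0.
have zM i : z i != ord_max by have := zb i; rewrite ltn_ord.
apply: csum_eq0 => s sT _; rewrite /rainbow; case: (boolP (perm_eq _ _)) => // sp.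
exfalso; apply: noz; exists z, s; split => // y /sT[T _ ->] i.
have zi : (z i < M.+1)%N.
  by rewrite ltn_neqAle -ltnS ltn_ord andbT; have := zM i; rewrite -val_eqE.
rewrite ffunE sum_grid_step; case: ifP => _; last by rewrite addr0 leqnn leqnSn.
by rewrite /= modnDmr modn_small addn1 ?leqnSn ?leqnn// ltnS.
Qed.

End Kuhn.

(** Label a point by the first direction [i] whose face at [ord0] its colour misses, or by [m] if
    there is none. Since no colour meets opposite faces, Sperner's conditions hold; distinct labels
    then come from distinct colours. *)
Lemma lebesgue_grid (m M : nat) (C : eqType) (L : {ffun 'I_m -> 'I_M.+2} -> C) :
  (forall (i : 'I_m) (y z : {ffun 'I_m -> 'I_M.+2}), y i = ord0 ->
    z i = ord_max -> L y != L z) ->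
  exists (z : {ffun 'I_m -> 'I_M.+2}) (s : seq {ffun 'I_m -> 'I_M.+2}),
  [/\ forall y, y \in s -> forall i, (z i <= y i <= (z i).+1)%N,
    size s = m.+1 & uniq (map L s)].
Proof.
move=> Lopp.
pose touch (c : C) (i : 'I_m) :=
  [exists y : {ffun 'I_m -> 'I_M.+2}, (y i == ord0) && (L y == c)].
pose mu c := find (fun i => ~~ touch c i) (enum 'I_m).
have mu_le c : (mu c <= m)%N.
  by rewrite /mu (leq_trans (find_size _ _))// size_enum_ord.
have [||z [s [_ zs sp]]] := @kuhn m M (mu \o L) (fun=> mu_le _).
- move=> z i zi; apply/eqP; rewrite /= => muE;
  have mum : (mu (L z) < size (enum 'I_m))%N.
    by rewrite muE size_enum_ord.
  move: mum; rewrite -has_find => /(nth_find i).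
  rewrite -/(mu (L z)) muE nth_ord_enum => /existsP[]; exists z.
  by rewrite zi !eqxx.
- move=> z i zi; rewrite leqNgt; apply/negP => /(before_find i).
  rewrite nth_ord_enum => /negbFE/existsP[y /andP[/eqP yi /eqP yz]].
  by have := Lopp _ _ _ yi zi; rewrite yz eqxx.
exists z, s; split => //; first by
  rewrite -(size_map (mu \o L)) (perm_size sp) size_iota.
by move: (perm_uniq sp); rewrite iota_uniq map_comp => /map_uniq.
Qed.

(** * Rounding *)

Lemma uniq_map_factor (A : Type) (B C : eqType) (f : A -> B)
    (g : A -> C) (s : seq A) :
  (forall x y, g x = g y -> f x = f y) -> uniq (map f s) -> uniq (map g s).
Proof.
move=> gf; elim: s => //= x s IH /andP[xs /IH ->]; rewrite andbT.
apply: contraNN xs; elim: s {IH} => //= y s IH;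
  rewrite !inE => /orP[/eqP/gf ->|/IH ->].
  by rewrite eqxx.
by rewrite orbT.
Qed.

Section Rounding.
Variable R : realType.
Implicit Types (t th : R) (ts : seq R).

Definition fpart t : R := t - (Num.floor t)%:~R.

Lemma fpart_itv t : 0 <= fpart t < 1.
Proof.
by rewrite /fpart subr_ge0 floor_le/= ltrBlDl; have := floorD1_gt t; rewrite intrD.
Qed.

Definition fparts ts := undup [seq x <- map fpart ts | x != 0].

Definition rounding ts th : seq int := [seq Num.floor (t + th) | t <- ts].

Lemma floorD_fpart t th : 0 <= th < 1 ->
  Num.floor (t + th) = if 1 - th <= fpart t then Num.floor t + 1 else Num.floor t.
Proof.
move=> /andP[th0 th1]; have /andP[] := fpart_itv t.
rewrite /fpart; case: (leP (1 - th)) => h h0 h1; apply: floor_def;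
  rewrite !intrD ?mulr1z; apply/andP; split; lra.
Qed.

Lemma subpred_count_eq (T : eqType) (a b : pred T) (s : seq T) :
  subpred a b -> count a s = count b s -> {in s, a =1 b}.
Proof.
move=> ab; elim: s => //= x s IH.
have := sub_count ab s; have := ab x.
case ax: (a x); case bx: (b x) => // h cs; rewrite ?add0n ?add1n => e y.
- by rewrite inE => /orP[/eqP ->|]; [rewrite ax bx|apply: IH; case: e].
- by have := h isT.
- by rewrite e ltnn in cs.
- by rewrite inE => /orP[/eqP ->|]; [rewrite ax bx|apply: IH].
Qed.

(* As [th] grows from 0 to 1, [rounding ts th] changes only when [1 - th]
   crosses one of the nonzero fractional parts. *)
Lemma size_roundings ts (ths : seq R) :
  all (fun th => 0 <= th < 1) ths -> uniq (map (rounding ts) ths) ->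
  (size ths <= (size (fparts ts)).+1)%N.
Proof.
(* [c th] counts the crossings made up to [th]. It determines the rounding and takes at most
   [(size (fparts ts)).+1] values. *)
move=> ths01 uths; pose c th := count (fun x => 1 - th <= x) (fparts ts).
have cle th th' : 0 <= th < 1 -> 0 <= th' < 1 -> th <= th' -> c th = c th' ->
  rounding ts th = rounding ts th'.
  move=> th01 th01' le_th cth; apply/eq_in_map => t tts; rewrite !floorD_fpart//.
  have [ft0|ft0] := eqVneq (fpart t) 0.
    by rewrite ft0 !ifF//; apply/negbTE; rewrite -ltNge; lra.
  suff -> : (1 - th <= fpart t) = (1 - th' <= fpart t) by [].
  apply: (subpred_count_eq _ cth) => [x|]; first by apply: le_trans; lra.
  by rewrite mem_undup mem_filter ft0 map_f.
have : uniq (map c ths).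
  (* The subtype makes the bounds on [th] available to [uniq_map_factor]. *)
  have -> : map c ths =
      map (fun x => c (val x)) (pmap insub ths : seq {x : R | 0 <= x < 1}).
    elim: ths ths01 {uths} => //= th ths IH /andP[h /IH ->].
    by rewrite insubT.
  apply: (@uniq_map_factor _ _ _ (fun x => rounding ts (val x))).
    move=> [x x01] [y y01] /= cxy; have [xy|/ltW yx] := leP x y; first exact: cle.
    by apply/esym/cle.
  move: uths; congr (is_true (uniq _)).
  elim: ths ths01 => //= th ths IH /andP[h /IH ->].
  by rewrite insubT.
move=> uc; rewrite -(size_map c) -(size_iota 0 (size (fparts ts)).+1).
apply: uniq_leq_size => // _ /mapP[th _ ->].
by rewrite mem_iota add0n ltnS count_size.
Qed.

(* Pigeonhole: among the [k.+1] shifts [(2r + 1) / (2 (k + 1))], each of the at most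
   [k] nonzero fractional parts rules out at most one. *)
Lemma robust_shift (k : nat) ts : (size (fparts ts) <= k)%N ->
  exists2 th, 0 <= th < 1 & forall t t', t \in ts ->
    `|t' - t| < (2 * k.+1%:R)^-1 -> Num.floor (t' + th) = Num.floor (t + th).
Proof.
move=> fk; apply: contrapT => nth.
have [q qE] : exists q : R, q = k.+1%:R by eexists.
have q0 : 0 < q by rewrite qE ltr0n.
have [e eE] : exists e : R, e = (2 * q)^-1 by eexists.
have e0 : 0 < e by rewrite eE invr_gt0; lra.
have qe : q * e = 2^-1 by rewrite eE invfM mulrCA divff ?mulr1// gt_eqF.
rewrite -qE -eE in nth.
pose th (r : nat) : R := (2 * r%:R + 1) * e.
have th01 (r : 'I_k.+1) : e <= th r <= 1 - e.
  have rq : r%:R + 1 <= q by rewrite qE natr1 ler_nat ltn_ord.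
  have r0 : 0 <= r%:R :> R by rewrite ler0n.
  have re := mulr_ge0 r0 (ltW e0).
  have re1 : (r%:R + 1) * e <= q * e by rewrite ler_pM2r.
  by rewrite /th; apply/andP; split; lra.
(* If the floor changes near [t], then [t + th r] is within [e] of an integer, recorded as the
   second component. *)
have bad (r : 'I_k.+1) : exists tz : R * int, tz.1 \in ts /\
    `|tz.1 + th r - tz.2%:~R| < e.
  apply: contrapT => nbad; apply: nth; exists (th r).
    have := th01 r.
    by move=> /andP[? ?]; apply/andP; split; lra.
  move=> t t' tts tt'; apply: contrapT => /eqP fl; apply: nbad.
  have [l1 u1] := (floor_le (t + th r), floorD1_gt (t + th r)).
  have [l2 u2] := (floor_le (t' + th r), floorD1_gt (t' + th r)).
  move: tt'; rewrite ltr_norml => /andP[tt1 tt2].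
  have [lt_fl|lt_fl|/eqP] :=
    ltgtP (Num.floor (t' + th r)) (Num.floor (t + th r));
    last by rewrite (negPf fl).
    exists (t, Num.floor (t + th r)); split => //=.
    move: lt_fl; rewrite floor_lt_int => lt_fl.
    by rewrite ltr_norml; apply/andP; split; lra.
  exists (t, Num.floor (t' + th r)); split => //=.
  move: lt_fl; rewrite floor_lt_int => lt_fl.
  by rewrite ltr_norml; apply/andP; split; lra.
have [f fP] := choice bad.
have : (k.+1 <= size (fparts ts))%N.
  have q2 : 2 * e * q = 1 by lra.
  rewrite -(size_enum_ord k.+1) -(size_map (fun r => fpart (f r).1)).
  apply: uniq_leq_size => [|_ /mapP[r _ ->]].
    rewrite map_inj_uniq ?enum_uniq// => r r' ff'.
    have [_ h] := fP r; have [_ h'] := fP r'.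
    pose w : int := Num.floor (f r).1 - Num.floor (f r').1 - (f r).2 + (f r').2.
    have wE : (f r).1 - (f r').1 =
        (Num.floor (f r).1)%:~R - (Num.floor (f r').1)%:~R.
      by move: ff'; rewrite /fpart; lra.
    (* Shifts spoiled by the same fractional part differ by less than [2 * e] modulo 1; multiplied
       by [q] this is an integer of absolute value below 1, hence 0. *)
    have : `|th r - th r' + w%:~R| * q < 1.
      rewrite -[X in _ < X]q2 ltr_pM2r//.
      move: h h'; rewrite /w !(intrD, rmorphN) /= !ltr_norml =>
        /andP[? ?] /andP[? ?].
      by apply/andP; split; lra.
    rewrite -[X in _ * X]gtr0_norm// -normrM mulrDl mulrBl.
    have -> : th r * q - th r' * q + w%:~R * q = (r%:Z - r'%:Z + w * k.+1%:Z)%:~R.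
      rewrite !(intrD, rmorphN, intrM) /= -!pmulrn.
      by rewrite -qE /th; have := congr1 (fun x => x * r%:R) qe;
        have := congr1 (fun x => x * r'%:R) qe; lra.
    rewrite -intr_norm -[X in _ < X]/(1%:~R) ltr_int => small.
    apply: val_inj => /=; have := ltn_ord r; have := ltn_ord r'.
    move: small; generalize (nat_of_ord r) (nat_of_ord r') w => a b c.
    have [c0|c0|->] := ltgtP c 0 => *; nia.
  have [fts h] := fP r.
  (* An integer [(f r).1] would put [th r] within [e] of an integer, although
     [e <= th r <= 1 - e]. *)
  rewrite mem_undup mem_filter map_f// andbT /fpart subr_eq0; apply/eqP => fE.
  move: h; rewrite fE => h.
  have := th01 r => /andP[t1 t2].
  have [w0|w0] := leP ((f r).2 - Num.floor (f r).1) 0.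
    have : ((f r).2 - Num.floor (f r).1)%:~R <= 0 :> R by rewrite lerz0.
    rewrite intrD rmorphN /= => ?.
    by move: h; rewrite ltr_norml => /andP[? ?]; lra.
  have : 1 <= ((f r).2 - Num.floor (f r).1)%:~R :> R by rewrite ler1z -gtz0_ge1.
  rewrite intrD rmorphN /= => ?.
  by move: h; rewrite ltr_norml => /andP[? ?]; lra.
by rewrite leqNgt ltnS fk.
Qed.

End Rounding.

Local Open Scope classical_set_scope.

(** * Continuous maps on the cube *)

Lemma heine (R : realType) (m N : nat) (U : 'rV[R]_m -> 'rV[R]_N)
    (C : set 'rV[R]_m) (eta : R) :
  compact C -> continuous U -> 0 < eta ->
  exists2 d : R, 0 < d & forall x y, C x -> ball x d y -> ball (U x) eta (U y).
Proof.
move=> Cc Uc eta0.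
have := (compact_near_coveringP C).1 Cc R (0^'+) (fun d x =>
  forall y, ball x d y -> ball (U x) eta (U y)) _.
case=> [|e /= e0 he].
  move=> x Cx; have /nbhs_ballP[r /= r0 hr] : nbhs x (U @^-1` ball (U x) (eta / 2)).
    by apply: Uc; apply: nbhsx_ballx; rewrite divr_gt0.
  exists (ball x (r / 2), [set d | 0 < d < r / 2]) => /=.
    split; first by apply: nbhsx_ballx; rewrite divr_gt0.
    near=> d; apply/andP; split => //; near: d; apply: nbhs_right_lt;
      rewrite divr_gt0//.
  move=> [x' d] /= [xx' /andP[d0 dr] y x'y].
  have h1 : ball (U x) (eta / 2) (U x').
    apply: hr; apply: le_ball xx'; lra.
  have h2 : ball (U x) (eta / 2) (U y).
    apply: hr; rewrite (splitr r); apply: ball_triangle xx' _;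
      apply: le_ball x'y; lra.
  rewrite (splitr eta); apply: ball_triangle h2; exact: ball_sym.
exists (e / 2); first by rewrite divr_gt0.
move=> x y Cx xy; apply: (he (e / 2)) => //=; last by rewrite divr_gt0.
by rewrite sub0r normrN gtr0_norm ?divr_gt0//; lra.
Unshelve. all: by end_near. Qed.

Definition unit_cube (R : realType) (m : nat) : set 'rV[R]_m :=
  [set v | forall i, `[0, 1]%classic (v ord0 i)].

Lemma unit_cube_compact (R : realType) (m : nat) : compact (@unit_cube R m).
Proof.
by apply: (@rV_compact R m (fun=> `[0, 1]%classic)) => i; exact: segment_compact.
Qed.

(** For each direction the distance attains its minimum on the compact product of the two opposite
    faces. *)
Lemma opposite_dist (R : realType) (m N : nat) (U : 'rV[R]_m -> 'rV[R]_N) :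
  continuous U ->
  (forall i g h, unit_cube g -> unit_cube h -> g ord0 i = 0 -> h ord0 i = 1 ->
    U g <> U h) ->
  exists2 d : R, 0 < d & forall i g h, unit_cube g -> unit_cube h ->
    g ord0 i = 0 -> h ord0 i = 1 -> d <= `|U g - U h|.
Proof.
move=> Uc Uopp.
have dist1 i : exists d : R, 0 < d /\ forall g h, unit_cube g -> unit_cube h ->
  g ord0 i = 0 -> h ord0 i = 1 -> d <= `|U g - U h|.
  pose side (a : R) := [set v : 'rV[R]_m | forall j,
    (if j == i then [set a] else `[0, 1]%classic) (v ord0 j)].
  have sidec a : compact (side a).
    apply: (@rV_compact R m
      (fun j => if j == i then [set a] else `[0, 1]%classic)) => j.
    by case: eqP => _; [exact: compact_set1|exact: segment_compact].
  have sideP a v : 0 <= a <= 1 -> side a v <-> unit_cube v /\ v ord0 i = a.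
    move=> a01; split => [sv|[cv va] j]; last by case: eqP => [->|//].
    have va := sv i; rewrite eqxx in va; split => // j.
    by have := sv j; case: eqP => // -> ->; rewrite /= in_itv.
  pose K := side 0 `*` side 1.
  have [|||c cK cmin] := @compact_EVT_min _ R (fun gh : 'rV[R]_m * 'rV[R]_m =>
    `|U gh.1 - U gh.2|) K.
  - exists (const_mx 0, const_mx 1); split => /= j; rewrite mxE; case: eqP => _ //=.
      by rewrite in_itv/= lexx ler01.
    by rewrite in_itv/= lexx ler01.
  - exact: compact_setX.
  - apply: continuous_subspaceT => gh; apply: cvg_norm.
    by apply: cvgB; apply: continuous_comp;
      [exact: cvg_fst|exact: Uc|exact: cvg_snd|exact: Uc].
  have [c1 c2] : K c by rewrite inE in cK.
  have [cc1 c10] : unit_cube c.1 /\ c.1 ord0 i = 0 by apply/sideP;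
    rewrite ?lexx ?ler01.
  have [cc2 c21] : unit_cube c.2 /\ c.2 ord0 i = 1 by apply/sideP;
    rewrite ?lexx ?ler01.
  exists `|U c.1 - U c.2|; split.
    by rewrite normr_gt0 subr_eq0; apply/eqP; apply: Uopp c10 c21.
  move=> g h cg ch g0 h1; apply: (cmin (g, h)); rewrite inE; split => /=;
    apply/sideP; rewrite ?lexx ?ler01//.
have [d dP] := choice dist1.
(* The default 1 gives a positive bound even when [m] is 0. *)
exists (\big[Num.min/1]_i d i).
  by apply: lt_bigmin => [|i _]; [exact: ltr01|case: (dP i)].
move=> i g h cg ch g0 h1; apply: le_trans (bigmin_le _ i _) _.
exact: (dP i).2.
Qed.

(** [U] stands for barycentric coordinates rescaled to have maximum 1. Rounding a fine grid would
    otherwise give a colouring that contradicts [lebesgue_grid]. *)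
Lemma coincidence (R : realType) (m N k : nat) (U : 'rV[R]_m -> 'rV[R]_N) :
  (k < m)%N -> continuous U ->
  (forall v, exists2 j, U v ord0 j = 1 &
    (#|[pred j | U v ord0 j != 0%R]| <= k.+1)%N) ->
  exists i g h, [/\ unit_cube g, unit_cube h, g ord0 i = 0, h ord0 i = 1 &
    U g = U h].
Proof.
move=> km Uc Usupp; apply: contrapT => nU.
have [i g h cg ch g0 h1 ugh|d d0 dP] := opposite_dist Uc.
  by apply: nU; exists i, g, h.
(* Equal floors after shifts in [[0, 1)] leave the scaled entries less than 2 apart, so [q * d > 2]
   separates the colours on opposite faces. *)
pose q := (Num.truncn (2 / d)).+1.
have qd : 2 < q%:R * d by rewrite -ltr_pdivrMr// truncnS_gt.
have q0 : 0 < q%:R :> R by rewrite ltr0n.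
(* After scaling by [q], this is the tolerance of [robust_shift]. *)
pose eta : R := (2 * k.+1%:R)^-1 / q%:R.
have eta0 : 0 < eta by rewrite divr_gt0// invr_gt0 mulr_gt0// ltr0n.
have [r r0 rP] := heine (@unit_cube_compact R m) Uc eta0.
pose M := Num.truncn r^-1.
have Mr : M.+1%:R^-1 < r by rewrite invf_plt ?posrE ?ltr0n// truncnS_gt.
pose pt (z : {ffun 'I_m -> 'I_M.+2}) : 'rV[R]_m := \row_i ((z i)%:R / M.+1%:R).
have ptC z : unit_cube (pt z).
  move=> i; rewrite /= in_itv /= mxE divr_ge0//= ler_pdivrMr ?ltr0n// mul1r ler_nat.
  by rewrite -ltnS ltn_ord.
pose ts z : seq R := [seq q%:R * U (pt z) ord0 j | j <- enum 'I_N].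
have rE z t : rounding (ts z) t =
    [seq Num.floor (q%:R * U (pt z) ord0 j + t) | j <- enum 'I_N].
  by rewrite /rounding -map_comp.
(* The entry 1 becomes the integer [q], so only [k] of the [k.+1] possible nonzero entries can have
   a nonzero fractional part. *)
have sfparts z : (size (fparts (ts z)) <= k)%N.
  have [j Uj1 cU] := Usupp (pt z).
  rewrite -ltnS; apply: leq_trans cU; rewrite (cardD1 j) inE Uj1.
  rewrite oner_eq0 add1n ltnS.
  rewrite cardE -(size_map (fun j => fpart (q%:R * U (pt z) ord0 j))).
  apply: uniq_leq_size; first exact: undup_uniq.
  move=> x; rewrite mem_undup mem_filter => /andP[x0].
  rewrite -map_comp => /mapP[j' _ xE]; apply/mapP; exists j' => //.
  rewrite mem_enum !inE; apply/andP; split.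
    apply: contraNneq x0 => jj'; rewrite xE /= jj' Uj1 mulr1 /fpart.
    by rewrite -[q%:R]/(q%:~R) intrKfloor subrr.
  by apply: contraNneq x0 => jj'; rewrite xE /= jj' mulr0 /fpart floor0 subrr.
have shift z : exists th, 0 <= th < 1 /\ forall t t', t \in ts z ->
    `|t' - t| < (2 * k.+1%:R)^-1 -> Num.floor (t' + th) = Num.floor (t + th).
  by have [th ? ?] := robust_shift (sfparts z); exists th.
have [th thP] := choice shift.
have [|z [s [zs ss us]]] := @lebesgue_grid m M _ (fun z => rounding (ts z) (th z)).
  move=> i y z yi zi; apply/eqP => Lyz.
  have := dP i _ _ (ptC y) (ptC z); rewrite !mxE yi zi mul0r.
  rewrite divff ?pnatr_eq0// => /(_ erefl erefl) dU.
  have /mx_norm_neq0[[i0 j] /=] : `|U (pt y) - U (pt z)| != 0.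
    by rewrite gt_eqF// (lt_le_trans d0).
  rewrite -[mx_norm _]/`|U (pt y) - U (pt z)| ord1 !mxE => UE.
  have := congr1 (fun l => nth 0%Z l j) Lyz; rewrite /= !rE.
  have nE (F : 'I_N -> int) : nth 0%Z [seq F i | i <- enum 'I_N] j = F j.
    by rewrite (nth_map j) ?size_enum_ord// nth_ord_enum.
  rewrite !nE => flE.
  have [/andP[ty0 ty1] _] := thP y; have [/andP[tz0 tz1] _] := thP z.
  have := floor_le (q%:R * U (pt y) ord0 j + th y);
    have := floorD1_gt (q%:R * U (pt y) ord0 j + th y).
  have := floor_le (q%:R * U (pt z) ord0 j + th z);
    have := floorD1_gt (q%:R * U (pt z) ord0 j + th z).
  rewrite flE intrD mulr1z => u1 u2 u3 u4.
  have : q%:R * `|U (pt y) ord0 j - U (pt z) ord0 j| < 2.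
    rewrite -[X in X * _]gtr0_norm// -normrM mulrBr ltr_norml; apply/andP;
      split; lra.
  by rewrite ltNge -UE => /negP; apply; rewrite (le_trans (ltW qd))// ler_pM2l.
(* By robustness of [th y], the colour of each [y] in [s] is the rounding of the single list [ts z]
   with shift [th y]; [size_roundings] then applies. *)
have : (size s <= k.+1)%N.
  rewrite -(size_map th); apply: leq_trans (size_roundings (ts := ts z) _ _) _.
  - by apply/allP => _ /mapP[y _ ->]; case: (thP y).
  - move: us; congr (is_true (uniq _)).
    rewrite -map_comp; apply/eq_in_map => y ys /=.
    rewrite !rE; apply: eq_map => j /=.
    apply/esym; apply: (thP y).2; first by apply/mapP; exists j; rewrite ?mem_enum.
    have : ball (pt z) r (pt y).
      split => // i0 i; rewrite !mxE /ball /= -mulrBl normrM.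
      rewrite [X in _ * X]gtr0_norm ?invr_gt0//.
      apply: le_lt_trans Mr; rewrite -[leRHS]mul1r ler_pM2r ?invr_gt0//.
      have /andP[] := zs _ ys i; rewrite -(ler_nat R) -(ler_nat R (y i)).
      rewrite -natr1 => z1 z2.
      by rewrite ler_norml; apply/andP; split; lra.
    move=> /(rP _ _ (ptC z))[_ /(_ ord0 j)]; rewrite /ball /= /eta ltr_pdivlMr//.
    by rewrite -[X in _ * X < _]gtr0_norm// -normrM mulrBl ![_ * q%:R]mulrC.
  - by rewrite ltnS sfparts.
by rewrite ss ltnS leqNgt km.
Qed.

(** * Polyhedra *)

Section Polyhedra.
Variables (R : realType) (V : choiceType) (K : simplicial_complex V).
Local Notation P := (polyhedron R K).

Lemma polyhedron_inj (x y : P) : (forall v, x v = y v) -> x = y.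
Proof.
case: x y => [x px] [y py] /= xy; have {}xy : x = y by exact/funext.
by case: _ / xy py => py; congr Polyhedron; exact: Prop_irrelevance.
Qed.

Lemma polyhedron_ge0 (x : P) v : 0 <= x v.
Proof. by have [s _ []] := baryP x. Qed.

(** The support of [x]; the chosen face only makes it a finite set. *)
Definition carrier (x : P) : {fset V} :=
  [fset v in projT1 (cid2 (baryP x)) | 0 < x v]%fset.

Lemma mem_carrier (x : P) v : (v \in carrier x) = (x v != 0).
Proof.
rewrite !inE /=; case: cid2 => s Ks [x0 xs _] /=.
rewrite lt0r x0 andbT; have [//|/xs ->] := boolP (v \in s).
by rewrite eqxx.
Qed.

Lemma sum_bary (x : P) (t : {fset V}) : (carrier x `<=` t)%fset ->
  \sum_(v <- t) x v = 1.
Proof.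
move=> xt; rewrite -(big_fset_incl _ xt) => [|v _]; last first.
  by rewrite mem_carrier negbK => /eqP.
have [s Ks [x0 xs <-]] := baryP x.
apply: big_fset_incl => [|v _]; last by rewrite mem_carrier negbK => /eqP.
apply/fsubsetP => v; rewrite mem_carrier; apply: contraR => /xs ->; exact: eqxx.
Qed.

Lemma simplex_carrier (x : P) : simplex (carrier x) x.
Proof.
split; [exact: polyhedron_ge0| |exact: sum_bary].
by move=> v; rewrite mem_carrier negbK => /eqP.
Qed.

Lemma carrier_sub (x : P) (s : {fset V}) : simplex s x -> (carrier x `<=` s)%fset.
Proof.
by case=> _ xs _; apply/fsubsetP => v; rewrite mem_carrier;
  apply: contraR => /xs ->.
Qed.

Lemma face_carrier (x : P) : K (carrier x).
Proof.
have [s Ks /carrier_sub xs] := baryP x; apply: face_subset Ks xs _.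
apply/eqP => x0; have := sum_bary (fsubset_refl (carrier x)).
by rewrite x0 big_seq_fset0 => /eqP; rewrite eq_sym oner_eq0.
Qed.

Lemma polyhedron_openE (U : set P) : open U = weak_open U.
Proof. by []. Qed.

Lemma bary_continuous v : continuous (fun x : P => x v).
Proof.
apply/continuousP => A oA; rewrite polyhedron_openE => s Ks x xs Ax.
have /nbhs_ballP[e /= e0 eA] := open_nbhs_nbhs (conj oA Ax).
exists e => // y ys xy; apply: eA; rewrite /ball /=.
have [/xy //|vs] := boolP (v \in s).
by case: xs ys => _ -> // _ [_ -> // _]; rewrite subrr normr0.
Qed.

(** Choose one point of the image for each carrier that occurs. Each open set of a suitable cover
    contains at most one of these points, so a finite subcover leaves finitely many carriers; [t] is
    their union. *)
Lemma compact_carrier (T : ptopologicalType) (C : set T) (f : T -> P) :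
  compact C -> continuous f ->
  exists t : {fset V}, forall x, C x -> (carrier (f x) `<=` t)%fset.
Proof.
rewrite compact_cover => Cc fc.
pose D := [set s | exists2 x, C x & carrier (f x) = s].
have /choice[q qP] s : exists x, D s -> C x /\ carrier (f x) = s.
  by have [[x Cx xs]|] := pselect (D s); [exists x|exists point].
(* [U s] omits every representative but that of [s]: any set of representatives
   is closed because each simplex contains only finitely many of them. *)
pose U s := [set y : P | forall t, D t -> y = f (q t) -> t = s].
have oU s : open (U s).
  rewrite polyhedron_openE => r Kr x xr Ux.
  (* [e t] separates [x] from the representative of [t] inside [r]; only the finitely many subsets
     [t] of [r] matter. *)
  have /choice[e eP] t : exists e : R, 0 < e /\
      (D t -> t <> s -> simplex r (f (q t)) ->
      exists2 v, v \in r & e <= `|x v - f (q t) v|).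
    have [[Dt ts tr]|nt] := pselect [/\ D t, t <> s & simplex r (f (q t))];
      last first.
      by exists 1; split => // *; exfalso; apply: nt.
    have [v xv] : exists v, x v <> f (q t) v.
      apply: contrapT => nv; apply: ts; apply: Ux => //; apply: polyhedron_inj => v.
      by apply: contrapT => xv; apply: nv; exists v.
    exists `|x v - f (q t) v|; split; first by rewrite normr_gt0 subr_eq0;
      apply/eqP.
    move=> _ _ _; exists v => //; apply: contraPT xv => vr.
    by case: xr tr => _ -> // _ [_ -> // _].
  exists (\big[Num.min/1]_(t <- fpowerset r) e t).
    rewrite big_seq; apply: lt_bigmin => [|t _]; [exact: ltr01|by case: (eP t)].
  move=> y yr xy t Dt yE; apply: contrapT => ts.
  have tr : simplex r (f (q t)) by rewrite -yE.
  have [v vr] := (eP t).2 Dt ts tr; rewrite -yE leNgt => /negP; apply.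
  apply: lt_le_trans (xy v vr) _; apply: ge_bigmin_seq => //.
  by rewrite fpowersetE -(qP _ Dt).2 carrier_sub.
have [D' D'D Ccov] : finite_subset_cover D (fun s => f @^-1` U s) C.
  apply: Cc => [s _|x Cx]; first by move/continuousP: fc; apply.
  exists (carrier (f x)) => [|t Dt /= xt]; first by exists x.
  by rewrite xt (qP _ Dt).2.
exists (\bigcup_(s <- D') s)%fset => x Cx.
have Dx : D (carrier (f x)) by exists x.
have [s sD' Us] := Ccov _ (qP _ Dx).1.
have xs : carrier (f x) = s by exact: (Us _ Dx).
by rewrite xs; apply: bigfcup_sup.
Qed.

End Polyhedra.

(** * Obstruction from a cube with distant opposite faces *)

Lemma row_continuous (T : topologicalType) (R : realType) (N : nat)
    (f : T -> 'rV[R]_N) :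
  (forall j, continuous (fun x => f x ord0 j)) -> continuous f.
Proof.
move=> fc x; apply/cvg_ballP => e e0.
have : \forall y \near x, forall j, ball (f x ord0 j) e (f y ord0 j).
  apply: filter_forall => j; exact: (cvg_ball (fc j x)).
apply: filterS => y h; split => // i j; rewrite ord1; exact: h.
Qed.

Lemma eps_fiber (R : realType) (X : metricType R) (Y : topologicalType)
    (eps : R) (f : X -> Y) x y :
  eps_embedding eps f -> f x = f y -> mdist x y <= eps.
Proof.
move=> [_ fe] fxy; rewrite -lee_fin; apply: le_trans (fe (f x)).
by apply: ereal_sup_ubound; exists (x, y).
Qed.

(** [h] is defined on the whole space but takes only values from the unit cube, which makes
    continuity global while compactness of the cube still applies. *)
Lemma embeds_in_dim_cube (R : realType) (X : metricType R) (eps : R) (m k : nat)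
    (h : 'rV[R]_m -> X) :
  continuous h -> (forall v, exists2 w, unit_cube w & h v = h w) ->
  (forall i v w, unit_cube v -> unit_cube w -> v ord0 i = 0 -> w ord0 i = 1 ->
    eps < mdist (h v) (h w)) ->
  embeds_in_dim X eps k -> (m <= k)%N.
Proof.
move=> hc hcube hfar [V [K [f [[_ dimK] fe]]]]; rewrite leqNgt; apply/negP => km.
pose F v := f (h v).
have Fc : continuous F by move=> v; apply: continuous_comp; [exact: hc|exact: fe.1].
have [t tP] := compact_carrier (@unit_cube_compact R m) Fc.
have {}tP v : (carrier (F v) `<=` t)%fset.
  by have [w cw hvw] := hcube v; rewrite /F hvw; exact: tP.
pose vtx := tnth (in_tuple (t : seq V)).
have vtx_inj : injective vtx by apply/tuple_uniqP; exact: fset_uniq.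
pose Y v : 'rV[R]_(size (t : seq V)) := \row_j F v (vtx j).
have Yc : continuous Y.
  apply: row_continuous => j.
  rewrite (_ : (fun v => _) = (fun x : polyhedron R K => x (vtx j)) \o F);
    last first.
    by apply/funext => v; rewrite mxE.
  by move=> v; apply: continuous_comp; [exact: Fc|exact: bary_continuous].
have Ysum v : \sum_j Y v ord0 j = 1.
  rewrite -(sum_bary (tP v)) [RHS]big_tnth; apply: eq_bigr => j _; rewrite mxE.
  by [].
have Y0 v : 0 < `|Y v|.
  rewrite normr_gt0; apply/eqP => Yv0; have := Ysum v.
  by rewrite Yv0 big1 => [/eqP|j _]; rewrite ?mxE// eq_sym oner_eq0.
(* The norm is the largest entry, so the largest entry of [U v] is 1. *)
pose U v := `|Y v|^-1 *: Y v.
have Uc : continuous U.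
  move=> v.
  have Vc : {for v, continuous (fun v => `|Y v|^-1)}.
    apply: continuousV; first by rewrite gt_eqF.
    exact: (continuous_comp (Yc v) (@norm_continuous _ _ _)).
  exact: cvgZ Vc (Yc v).
have [|i [v [w [cv cw v0 w1 UE]]]] := coincidence km Uc.
  move=> v; have /mx_norm_neq0[[i j]] : `|Y v| != 0 by rewrite gt_eqF.
  rewrite /= ord1 -[mx_norm _]/`|Y v| => YE; exists j.
    have Yj : Y v ord0 j = `|Y v| by rewrite YE ger0_norm// mxE polyhedron_ge0.
    by rewrite /U mxE Yj mulVf// gt_eqF.
  apply: leq_trans (dimK _ (face_carrier (F v))).
  rewrite cardE -(size_map vtx); apply: uniq_leq_size;
    first by rewrite map_inj_uniq ?enum_uniq.
  move=> _ /mapP[j' + ->]; rewrite mem_enum inE mxE mulf_eq0 negb_or => /andP[_].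
  by rewrite mem_carrier mxE.
suff FE : F v = F w.
  have := hfar i v w cv cw v0 w1; rewrite ltNge => /negP; apply;
    exact: eps_fiber fe FE.
(* The entries of [Y] sum to 1, so the rescaled vector determines the scale. *)
have YE : Y v = Y w.
  have nE : `|Y v|^-1 = `|Y w|^-1.
    rewrite -[LHS]mulr1 -[RHS]mulr1 -{1}(Ysum v) -(Ysum w) !mulr_sumr.
    by apply: eq_bigr => j _; have := congr1 (fun M : 'rV_ _ => M ord0 j) UE;
      rewrite !mxE.
  by move: UE; rewrite /U nE => /scalerI; apply; rewrite invr_eq0 gt_eqF.
apply: polyhedron_inj => u; have [ut|ut] := boolP (u \in t).
  have ui : (index u t < size (t : seq V))%N by rewrite index_mem.
  have := congr1 (fun M : 'rV_ _ => M ord0 (Ordinal ui)) YE.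
  by rewrite !mxE /vtx (tnth_nth u) /= nth_index.
have z x : F x u = 0.
  by apply/eqP; rewrite -[_ == _]negbK -mem_carrier; apply: contraNN ut;
    exact: (fsubsetP (tP x)).
by rewrite !z.
Qed.

(** * Maps into complexes with finitely many vertices *)

Lemma continuous_sum (T : topologicalType) (R : realType) (I : Type)
    (r : seq I) (P : pred I) (f : I -> T -> R) :
  (forall i, continuous (f i)) -> continuous (fun x => \sum_(i <- r | P i) f i x).
Proof.
move=> fc; elim: r => [|i r IH] x.
  rewrite (_ : (fun x => _) = cst 0); first exact: cvg_cst.
  by apply/funext => y; rewrite big_nil.
rewrite (_ : (fun x => _) =
    (fun x => (if P i then f i x else 0) + \sum_(i <- r | P i) f i x)); last first.
  by apply/funext => y; rewrite big_cons; case: ifP; rewrite ?add0r.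
apply: continuousD; last exact: IH.
by case: (P i); [exact: fc|exact: cvg_cst].
Qed.

(** Near [x] the support of [f y] contains that of [f x], so both points lie in the closed simplex
    on [carrier (f y)], where weak openness compares them. There are finitely many such simplices,
    so one neighbourhood serves all. *)
Lemma polyhedron_continuous (R : realType) (V : finType) (K : simplicial_complex V)
    (T : topologicalType) (f : T -> polyhedron R K) :
  (forall v, continuous (fun x => f x v)) -> continuous f.
Proof.
move=> fc; apply/continuousP => A; rewrite polyhedron_openE => oA.
rewrite openE => x Ax; rewrite /interior.
have pos : \forall y \near x, forall v, f x v != 0 -> f y v != 0.
  apply: filter_forall => v; have [fxv|fxv] := eqVneq (f x v) 0;
    first by apply: nearW => y /eqP.
  have fxv0 : 0 < `|f x v| by rewrite normr_gt0.
  have : \forall y \near x, `|f x v - f y v| < `|f x v|.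
    by exact: (cvg_ball (fc v x)).
  apply: filterS => y + _.
  by apply: contraTneq => ->; rewrite subr0 ltxx.
have inA : \forall y \near x, forall s : {fset V}, K s -> simplex s (f x) ->
  simplex s (f y) -> A (f y).
  apply: filter_forall => s.
  have [[Ks xs]|ns] := pselect (K s /\ simplex s (f x)); last first.
    by apply: nearW => y Ks xs; exfalso; apply: ns.
  have [e e0 eP] := oA s Ks _ xs Ax.
  have : \forall y \near x, forall v, `|f x v - f y v| < e.
    by apply: filter_forall => v; exact: (cvg_ball (fc v x)).
  by apply: filterS => y ye _ _ ys; apply: eP.
apply: filterS2 pos inA => y ypos /(_ (carrier (f y))); apply;
  [exact: face_carrier| |exact: simplex_carrier].
have sub : (carrier (f x) `<=` carrier (f y))%fset.
  by apply/fsubsetP => v; rewrite !mem_carrier; exact: ypos.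
split; [exact: polyhedron_ge0| |exact: sum_bary].
move=> v; rewrite mem_carrier negbK => fyv; apply/eqP.
by apply: contraTT fyv; exact: ypos.
Qed.

Section Skeleton.
Variables (V : finType) (k : nat).

Definition skeleton_face (s : {fset V}) := s != fset0 /\ (#|` s| <= k.+1)%N.

Lemma skeleton_face_nonempty s : skeleton_face s -> s != fset0.
Proof. by case. Qed.

Lemma skeleton_face_vertex v : skeleton_face [fset v]%fset.
Proof. by split; [apply/fset0Pn; exists v; rewrite inE|rewrite cardfs1]. Qed.

Lemma skeleton_face_subset s t :
  skeleton_face s -> (t `<=` s)%fset -> t != fset0 -> skeleton_face t.
Proof.
by move=> [_ sk] ts; split => //; exact: leq_trans (fsubset_leq_card ts) sk.
Qed.

Definition skeleton : simplicial_complex V :=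
  SimplicialComplex skeleton_face_nonempty skeleton_face_vertex
    skeleton_face_subset.

Lemma skeleton_dim : (k < #|V|)%N -> complex_dim skeleton k.
Proof.
move=> kV; split; last by move=> s [].
have sz : #|` [fset x in take k.+1 (enum V)]%fset| = k.+1.
  by rewrite card_fseq undup_id ?take_uniq ?enum_uniq// size_takel// -cardE.
exists [fset x in take k.+1 (enum V)]%fset => //; split; last by rewrite sz.
by rewrite -cardfs_gt0 sz.
Qed.

End Skeleton.

(** * The ball *)

Lemma nonexpansive_continuous (R : realType) (X : metricType R) (f : X -> R) :
  (forall x y, `|f x - f y| <= mdist x y) -> continuous f.
Proof.
move=> fX x; apply/cvgrPdist_lt => e e0; near=> y.
apply: le_lt_trans (fX x y) _.
by near: y; apply/metricType_numDomainType.nbhs_mdistP; exists e.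
Unshelve. all: by end_near. Qed.

Lemma lipschitz_continuous (R : realType) (V : normedModType R) (X : metricType R)
    (f : V -> X) (c : R) :
  (forall x y, mdist (f x) (f y) <= c * `|x - y|) -> continuous f.
Proof.
move=> fc x; apply/metricType_numDomainType.cvgrPdist_lt => e e0; near=> y.
apply: le_lt_trans (fc x y) _.
have c1 : 0 < `|c| + 1 by rewrite ltr_wpDl.
apply: (@le_lt_trans _ _ ((`|c| + 1) * `|x - y|)).
  by apply: ler_wpM2r => //; rewrite (le_trans (ler_norm c))// lerDl.
rewrite -ltr_pdivlMl// mulrC; near: y.
by apply: cvgr_dist_lt; rewrite ?divr_gt0//.
Unshelve. all: by end_near. Qed.

Lemma max_affine_continuous (R : realType) (s t c : R) :
  continuous (fun a : R => Num.max (s * a - t) 0 * c).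
Proof.
move=> a.
have h0 : {for a, continuous (fun a : R => s * a - t)}.
  by apply: (@continuousB _ _ _ (fun a => s * a) (cst t));
    [exact: mulrl_continuous|exact: cvg_cst].
have h1 : {for a, continuous (fun a : R => Num.max (s * a - t) 0)}.
  apply: (@continuous_max R _ (fun a => s * a - t : R^o) (cst (0 : R^o))) => //.
  exact: cvg_cst.
have h2 : {for a, continuous (fun _ : R => c)} by exact: cvg_cst.
exact: (continuousM h1 h2).
Qed.

(** Either both numbers lie in [[-t, t]], or the thresholded parts force [a = b]. *)
Lemma max_shift_dist (R : realType) (a b t : R) : 0 <= t ->
  Num.max (a - t) 0 = Num.max (b - t) 0 ->
  Num.max (- a - t) 0 = Num.max (- b - t) 0 -> `|a - b| <= 2 * t.
Proof.
move=> t0; rewrite !maxElt ler_norml.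
case: (ltP (a - t) 0) => ?; case: (ltP (b - t) 0) => ?;
case: (ltP (- a - t) 0) => ?; case: (ltP (- b - t) 0) => ? *; apply/andP;
  split; lra.
Qed.

Section Ball.
Variables (R : realType) (p : R) (n : nat).
Hypothesis p1 : 1 <= p.
Local Notation B := (lp_ball p n).

Let p0 : 0 < p. Proof. exact: lt_le_trans ltr01 p1. Qed.

Lemma lp_ball_coord (x : B) i : `|x ord0 i| <= 1.
Proof.
rewrite leNgt; apply/negP => xi; have := lp_ballP x; rewrite leNgt => /negP; apply.
rewrite (bigD1 i)//= ltr_wpDr//; first by apply: sumr_ge0 => j _; exact: powR_ge0.
have -> : 1 = 1 `^ p :> R by rewrite powR1.
by apply: gt0_ltr_powR; rewrite ?nnegrE ?ler01.
Qed.

Lemma coord_le_dist (x y : B) i : `|x ord0 i - y ord0 i| <= mdist x y.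
Proof. exact: (le_bigmax _ (fun k => `|x ord0 k - y ord0 k|)). Qed.

Lemma lp_ball_coord_continuous i : continuous (fun x : B => x ord0 i).
Proof. by apply: nonexpansive_continuous => x y; exact: coord_le_dist. Qed.

(** Each coordinate gets one vertex per sign, weighted by the excess over [t], and [None] takes the
    remaining mass. At most [k] coordinates exceed [t], so at most [k.+1] vertices are active. *)
Lemma lp_ball_embedding (t eps : R) (k : nat) :
  (0 < n)%N -> 0 <= t -> 2 * t <= eps -> (k <= n)%N ->
  (forall x : B, (#|[pred i | (t < `|x ord0 i|)%R]| <= k)%N) ->
  embeds_in_dim B eps k.
Proof.
move=> n0 t0 teps kn few.
pose V : finType := option ('I_n * bool).
have cV : #|V| = (n * 2).+1 by rewrite card_option card_prod card_ord card_bool.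
(* Every excess is at most 1, so division by the number of vertices keeps the total at most 1. *)
pose c : R := #|V|%:R; have c0 : 0 < c by rewrite /c cV ltr0n.
pose g (x : B) (w : 'I_n * bool) : R :=
  Num.max ((-1) ^+ w.2 * x ord0 w.1 - t) 0 / c.
pose b x (v : V) : R := if v is Some w then g x w else 1 - \sum_w g x w.
have g0 x w : 0 <= g x w by rewrite divr_ge0 ?(ltW c0)// le_max lexx orbT.
have g1 x w : g x w <= c^-1.
  rewrite -[leRHS]mul1r ler_pM2r ?invr_gt0// ge_max ler01 andbT.
  have := lp_ball_coord x w.1; rewrite ler_norml => /andP[? ?].
  by case: (w.2); rewrite ?expr1 ?expr0; lra.
have gsum x : \sum_w g x w <= 1.
  apply: le_trans (ler_sum _ (fun w _ => g1 x w)) _.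
  rewrite sumr_const -[_ *+ _]mulr_natr mulrC ler_pdivrMr// mul1r /c ler_nat cV.
  by rewrite card_prod card_ord card_bool.
pose supp (x : B) : seq V :=
  None :: [seq Some (i, x ord0 i < 0) | i <- enum [pred i | (t < `|x ord0 i|)%R]].
have bsupp x v : v \notin supp x -> b x v = 0.
  case: v => [[i s]|]; last by rewrite mem_head.
  rewrite inE /= => /mapP ns; rewrite /g /=.
  suff h : (-1) ^+ s * x ord0 i - t <= 0 by rewrite (max_r h) mul0r.
  rewrite leNgt; apply/negP => h; apply: ns; exists i; rewrite ?mem_enum ?inE /=.
    by case: s h; rewrite ?expr1 ?expr0 => h; rewrite ltr_normr; apply/orP;
      [right|left]; lra.
  by congr (Some (_, _)); case: s h; rewrite ?expr1 ?expr0 => h; apply/esym;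
    [|apply/negbTE; rewrite -leNgt]; lra.
have bP x : exists2 s : {fset V}, skeleton V k s & simplex s (b x).
  exists [fset v in supp x]%fset.
    split; first by apply/fset0Pn; exists None; rewrite !inE.
    rewrite card_fseq (leq_trans (size_undup _))//= size_map -cardE ltnS;
      exact: few.
  split=> [[w|]|v|]; [exact: g0|by rewrite subr_ge0| |].
    by rewrite in_fset; exact: bsupp.
  transitivity (\sum_(v : V) b x v).
    rewrite big_uniq ?fset_uniq//= [RHS](bigID (fun v =>
      v \in [fset v in supp x]%fset)) /=.
    by rewrite [X in _ = _ + X]big1 ?addr0// => v; rewrite in_fset; exact: bsupp.
  rewrite (bigD1 None)//= [X in _ + X](_ : _ = \sum_w g x w) ?subrK//.
  rewrite (reindex_omap Some id) /=; last by case.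
  by apply: eq_bigl => w; rewrite eqxx.
exists V, (skeleton V k), (fun x => Polyhedron (bP x)); split.
  (* Dimension exactly [k] requires a face with [k.+1] vertices; [k <= n < #|V|] provides it. *)
  by apply: skeleton_dim; rewrite cV; lia.
split.
  apply: polyhedron_continuous => /=.
  have gc w : continuous (fun x => g x w).
    move=> x; exact: (continuous_comp (@lp_ball_coord_continuous w.1 x)
      (@max_affine_continuous R ((-1) ^+ w.2) t c^-1 _)).
  case=> [w|]; first exact: gc.
  have gs : continuous (fun x => \sum_w g x w) by apply: continuous_sum.
  move=> x; have h1 : {for x, continuous (cst (1 : R) : B -> R)}.
    by exact: cst_continuous.
  exact: (continuousB h1 (gs x)).
move=> y; apply: ub_ereal_sup => _ [[u v] /= [fu fv] <-]; rewrite lee_fin.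
apply: le_trans teps; apply: bigmax_le => [|i _]; first by rewrite mulr_ge0.
have bE w : g u w = g v w.
  exact: (congr1 (fun z : polyhedron R (skeleton V k) => z (Some w))
    (etrans fu (esym fv))).
have gE (w : 'I_n * bool) : Num.max ((-1) ^+ w.2 * u ord0 w.1 - t) 0 =
    Num.max ((-1) ^+ w.2 * v ord0 w.1 - t) 0.
  by have := bE w; rewrite /g => /mulIf; apply; rewrite invr_eq0 gt_eqF.
have := gE (i, true); have := gE (i, false); rewrite /= expr0 expr1.
rewrite /= !mul1r !mulN1r; exact: max_shift_dist.
Qed.

End Ball.

(** * Cubes inside the ball *)

Definition clamp (R : realType) (a : R) : R := Num.max 0 (Num.min a 1).

Lemma clamp_itv (R : realType) (a : R) : 0 <= clamp a <= 1.
Proof. by rewrite /clamp le_max lexx ge_max ler01 ge_min lexx orbT. Qed.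

Lemma clamp_id (R : realType) (a : R) : 0 <= a <= 1 -> clamp a = a.
Proof. by move=> /andP[a0 a1]; rewrite /clamp min_l// max_r. Qed.

Lemma clamp_dist (R : realType) (a b : R) : `|clamp a - clamp b| <= `|a - b|.
Proof.
rewrite /clamp ler_norml; have := ler_norm (a - b); have := ler_norm (b - a);
  rewrite distrC.
rewrite !maxElt !minElt.
case: (ltP a 1) => ?; case: (ltP b 1) => ?; case: ltP => ?; case: ltP => ? *;
  apply/andP; split; lra.
Qed.

(** The cube [[-a, a]^m] in the first [m] coordinates, the others being 0, lies in the ball when
    [m * a]^ p = 1[; its side]2 * a[then exceeds]eps[because]m < (2 / eps) [^ p]. Clamping extends
    its parametrisation to the whole space. *)
Lemma lp_ball_cube (R : realType) (p eps : R) (n m k : nat) (hp : 1 <= p) :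
  0 < eps -> (m <= n)%N -> m%:R < (2 / eps) `^ p ->
    embeds_in_dim (lp_ball p n) eps k -> (m <= k)%N.
Proof.
move=> eps0; case: m => // m mn meps.
have p0 : 0 < p by exact: lt_le_trans ltr01 hp.
pose a : R := m.+1%:R^-1 `^ p^-1.
have m0 : 0 < m.+1%:R :> R by rewrite ltr0n.
have a0 : 0 <= a by exact: powR_ge0.
have ap : a `^ p = m.+1%:R^-1.
  by rewrite -powRrM mulVf ?gt_eqF// powRr1// invr_ge0 ltW.
have aeps : eps < 2 * a.
  rewrite -ltr_pdivrMl// mulrC ltNge; apply/negP => ae.
  have := ge0_ler_powR (ltW p0) _ _ ae; rewrite !nnegrE ap =>
    /(_ a0 (divr_ge0 (ltW eps0) (ler0n _ 2))).
  apply/negP; rewrite -ltNge -[eps / 2]invrK invf_div.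
  by rewrite -powR_inv1 ?divr_ge0 ?(ltW eps0)// -powRrM mulN1r powRN ltf_pV2//
    posrE ?powR_gt0 ?divr_gt0.
pose co (v : 'rV[R]_m.+1) (j : 'I_n) : R :=
  if insub (j : nat) is Some i then a * (2 * clamp (v ord0 i) - 1) else 0.
have coP v : \sum_(j < n) `|(\row_j co v j) ord0 j| `^ p <= 1.
  apply: (@le_trans _ _ (\sum_(j < n) (if (j < m.+1)%N then m.+1%:R^-1 else 0))).
    apply: ler_sum => j _; rewrite mxE /co; case: insubP => [i ji _|/negPf ->];
      last first.
      by rewrite normr0 powR0// gt_eqF.
    rewrite ji -ap normrM ger0_norm//; apply: ge0_ler_powR;
      rewrite ?nnegrE ?mulr_ge0 ?(ltW p0)//.
    have /andP[c0 c1] := clamp_itv (v ord0 i).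
    by rewrite ger_pMr ?powR_gt0 ?invr_gt0// ler_norml; apply/andP; split; lra.
  rewrite -big_mkcond (big_ord_narrow mn) sumr_const card_ord.
  by rewrite -[_ *+ _]mulr_natr mulVf// gt_eqF.
pose h v : lp_ball p n := LpBall (coP v).
have cl (v : 'rV[R]_m.+1) : unit_cube v -> forall i, clamp (v ord0 i) = v ord0 i.
  by move=> cv i; apply: clamp_id; have := cv i; rewrite /= in_itv.
apply: (@embeds_in_dim_cube _ _ _ _ _ h).
- apply: (@lipschitz_continuous _ _ _ _ (2 * a)) => v w.
  apply: bigmax_le => [|j _]; first by rewrite !mulr_ge0.
  rewrite /= !mxE /co; case: insubP => [i _ _|_];
    last by rewrite subrr normr0 !mulr_ge0.
  rewrite (_ : _ - _ = 2 * a * (clamp (v ord0 i) - clamp (w ord0 i))); last by ring.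
  rewrite normrM ger0_norm ?mulr_ge0// ler_wpM2l ?mulr_ge0//.
  apply: le_trans (clamp_dist _ _) _.
  have -> : v ord0 i - w ord0 i = (v - w) ord0 i by rewrite !mxE.
  rewrite [leRHS]/Num.norm /= mx_normrE.
  exact: (le_bigmax _ (fun ij => `|(v - w) ij.1 ij.2|) (ord0, i)).
- move=> v; exists (\row_i clamp (v ord0 i)).
    by move=> i; rewrite /= mxE in_itv; exact: clamp_itv.
  apply: val_inj; apply/rowP => j; rewrite !mxE /co; case: insubP => // i _ _.
  by rewrite mxE (clamp_id (clamp_itv _)).
- move=> i v w cv cw vi wi; apply: lt_le_trans aeps _.
  apply: le_trans (coord_le_dist (h v) (h w) (widen_ord mn i)).
  rewrite /= !mxE /co /= valK.
  rewrite !cl// vi wi ler_normr; apply/orP; right; lra.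
Qed.

Theorem corollary1p2 (R : realType) (p : R) (hp : 1 <= p)
    (eps : R) (heps : 0 < eps) (n : nat) (hn : (1 <= n)%N) :
  is_Widim (lp_ball p n) eps
    (Num.min (n%:Z) (Num.ceil ((2 / eps) `^ p) - 1)).
Proof.
have p0 : 0 < p by exact: lt_le_trans ltr01 hp.
set c := (2 / eps) `^ p.
have c0 : 0 < c by rewrite powR_gt0// divr_gt0.
(* [q] is the natural number with [q < c <= q + 1]. *)
pose q := `|Num.ceil c - 1|%N.
have qE : Num.ceil c - 1 = q%:Z.
  by rewrite /q gez0_abs// subr_ge0 -gtz0_ge1 ceil_gt0.
have cq : c <= q%:R + 1.
  have := ceil_ge c; rewrite -[Num.ceil c](subrK 1) qE intrD mulr1z.
  exact.
have qc : q%:R < c.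
  have := ceilB1_lt c; rewrite qE; exact.
have -> : Num.min n%:Z (Num.ceil c - 1) = (minn n q)%:Z.
  by rewrite qE; lia.
split.
  exists (minn n q) => //; have [nq|qn] := leqP n q.
    (* At threshold 0 all [n] coordinates may be active. *)
    apply: (@lp_ball_embedding _ _ _ hp 0) => //; first by rewrite mulr0 ltW.
    by move=> x; rewrite -[X in (_ <= X)%N]card_ord max_card.
  have e2 : 0 < eps / 2 by rewrite divr_gt0.
  apply: (@lp_ball_embedding _ _ _ hp (eps / 2)) => //;
    rewrite ?(ltW e2) ?(ltnW qn)//.
    by rewrite mulrC divfK.
  move=> x; rewrite leqNgt; apply/negP => qx.
  set A := [pred i | _] in qx.
  (* More than [q] coordinates above [eps / 2] means at least [q + 1 >= c] of them, each
     contributing more than [1 / c]: the total would exceed 1. *)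
  have ce : c * (eps / 2) `^ p = 1.
    by rewrite /c -powRM ?divr_ge0 ?(ltW heps)// mulrA divfK ?gt_eqF// divff ?powR1.
  have := lp_ballP x; rewrite leNgt => /negP; apply.
  apply: (@le_lt_trans _ _ (#|A|%:R * (eps / 2) `^ p)).
    rewrite -[X in X <= _]ce ler_pM2r ?powR_gt0//; apply: le_trans cq _.
    by rewrite natr1 ler_nat.
  rewrite (bigID A) /= -[X in X < _]addr0 ltr_leD//; last first.
    by apply: sumr_ge0 => i _; exact: powR_ge0.
  have xA i : i \in A -> (eps / 2) `^ p < `|x ord0 i| `^ p.
    by move=> iA; apply: gt0_ltr_powR; rewrite ?nnegrE ?(ltW e2).
  have /card_gt0P[i iA] : (0 < #|A|)%N by exact: leq_trans qx.
  rewrite mulrC mulr_natr -sumr_const (bigD1 i)//= [X in _ < X](bigD1 i)//=.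
  apply: ltr_leD; first exact: xA.
  by apply: ler_sum => j /andP[jA _]; rewrite ltW// xA.
move=> _ [k kemb <-]; rewrite lez_nat; apply: (lp_ball_cube hp heps _ _ kemb);
  first exact: geq_minl.
by apply: le_lt_trans qc; rewrite ler_nat geq_minr.
Qed.
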